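(* For any integers $n\ge1$ and $N\ge1$, the concentration $\kappa$ of $\mathrm{FvML}(\mu,\kappa)$ admits no unbiased estimator based on $N$ i.i.d. observations. That is, there is no Borel-measurable function $\hat\kappa\colon(\mathbb{S}^{n-1})^N\to\mathbb{R}$ such that $\mathbb{E}_{\mu,\kappa}[|\hat\kappa|]<\infty$ and $\mathbb{E}_{\mu,\kappa}[\hat\kappa]=\kappa$ for all $(\mu,\kappa)\in\mathbb{S}^{n-1}\times(0,\infty)$.
   Context: $\mathbb{S}^{n-1}=\{x\in\mathbb{R}^n:\|x\|=1\}$ and $\sigma$ is its surface measure (the $(n-1)$-dimensional Hausdorff measure); for $n=1$, $\mathbb{S}^0=\{-1,+1\}$ and $\sigma$ is counting measure. For $\mu\in\mathbb{S}^{n-1}$ and $\kappa>0$, the Fisher--von Mises--Langevin distribution $\mathrm{FvML}(\mu,\kappa)$ is the probability measure on $\mathbb{S}^{n-1}$ with density with respect to $\sigma$ $$f(x;\mu,\kappa)=C_n(\kappa)\,e^{\kappa\mu^\top x},\qquad C_n(\kappa)=\frac{\kappa^{n/2-1}}{(2\pi)^{n/2}I_{n/2-1}(\kappa)},$$ where $I_\nu(\kappa)=\sum_{m\ge0}\frac{(\kappa/2)^{\nu+2m}}{m!\,\Gamma(\nu+m+1)}$ is the modified Bessel function of the first kind. $C_n(\kappa)$ is the normalizing constant. $\mathbb{E}_{\mu,\kappa}$ denotes expectation under the $N$-fold product measure $P_{\mu,\kappa}^{\otimes N}$ on $(\mathbb{S}^{n-1})^N$ (the law of $N$ i.i.d.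 $\mathrm{FvML}(\mu,\kappa)$ observations). *)

(* Defs.v *)
From HB Require Import structures.
From mathcomp Require Import all_boot all_order all_algebra.
From mathcomp Require Import all_classical all_reals all_analysis.

Set Implicit Arguments.
Unset Strict Implicit.
Unset Printing Implicit Defensive.

Import Order.TTheory GRing.Theory Num.Theory.
Import numFieldTopology.Exports numFieldNormedType.Exports.

Local Open Scope classical_set_scope.
Local Open Scope ring_scope.

Section euclidean.
Context {R : realType} {n : nat}.
Implicit Types x y : 'rV[R]_n.

Definition dotp x y : R := \sum_(i < n) x 0 i * y 0 i.

(* The library norm on 'rV[R]_n is the sup norm; this is the Euclidean one
   (it induces the same topology). *)
Definition enorm x : R := Num.sqrt (dotp x x).

End euclidean.

Section special_functions.
Context {R : realType}.

(* Meaningful for 0 < x. *)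
Definition Gamma (x : R) : R :=
  \int[lebesgue_measure]_(t in `]0, +oo[) (t `^ (x - 1) * expR (- t)).

(* Modified Bessel function of the first kind, meaningful for -1 < nu, 0 < k. *)
Definition besselI (nu k : R) : R :=
  limn (series (fun m : nat =>
    (k / 2) `^ (nu + m.*2%:R) / (m`!%:R * Gamma (nu + m%:R + 1)))).

End special_functions.

Section hausdorff.
Context {R : realType} {n : nat}.
Local Open Scope ereal_scope.
Implicit Types (d : nat) (A : set 'rV[R]_n).

(* diam set0 = -oo *)
Definition diam A : \bar R :=
  ereal_sup [set (enorm (xy.1 - xy.2))%:E | xy in A `*` A].

(* Volume of the d-dimensional Euclidean ball of diameter 1; with this
   normalization the d-dimensional Hausdorff measure is the usual d-dimensional
   area, and the counting measure for d = 0. *)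
Definition ball_volume d : R :=
  (pi `^ (d%:R / 2) / (2 ^+ d * Gamma (d%:R / 2 + 1)))%R.

(* When d = 0 and A is a nonempty set of any diameter, diam A ^+ d = 1. *)
Definition hausdorff_gauge d A : \bar R :=
  if A == set0 then 0 else (ball_volume d)%:E * diam A ^+ d.

Definition hausdorff_content d (delta : R) A : \bar R :=
  ereal_inf [set \sum_(0 <= i <oo) hausdorff_gauge d (U i) |
    U in [set U : nat -> set 'rV[R]_n |
      A `<=` \bigcup_i U i /\ forall i, diam (U i) <= delta%:E]].

Definition hausdorff d A : \bar R :=
  ereal_sup [set hausdorff_content d delta A |
    delta in [set delta : R | (0 < delta)%R]].

End hausdorff.

(* S^n in R^(n+1), so that it is never empty; set_type carries the subspace
   topology. *)
Definition unit_sphere (R : realType) (n : nat) : set 'rV[R]_n.+1 :=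
  [set x | enorm x = 1].

Lemma unit_sphere_delta (R : realType) (n : nat) :
  delta_mx 0 0 \in @unit_sphere R n.
Proof.
rewrite inE /unit_sphere /= /enorm /dotp (bigD1 ord0)//= big1 ?addr0.
  by rewrite !mxE !eqxx mulr1 sqrtr1.
by move=> i /negbTE i0; rewrite !mxE i0 andbF mulr0.
Qed.

HB.instance Definition _ (R : realType) (n : nat) :=
  isPointed.Build (set_type (@unit_sphere R n))
    (exist (fun x => x \in @unit_sphere R n) _ (unit_sphere_delta R n)).

Definition sphere (R : realType) (n : nat) :=
  g_sigma_algebraType (@open (set_type (@unit_sphere R n))).

Section fvml.
Context {R : realType} {n : nat}.
Local Open Scope ereal_scope.

Definition sphere_val (x : sphere R n) : 'rV[R]_n.+1 := \val x.

(* The n-dimensional Hausdorff measure on S^n. This and the set functions below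
   are given on all subsets; they are countably additive on measurable ones. *)
Definition surface_measure (A : set (sphere R n)) : \bar R :=
  hausdorff n (sphere_val @` A).

(* C_p(k), with p the dimension of the ambient space. *)
Definition fvml_const (p : nat) (k : R) : R :=
  (k `^ (p%:R / 2 - 1) /
    ((2 * pi) `^ (p%:R / 2) * besselI (p%:R / 2 - 1) k))%R.

Definition fvml_density (mu : sphere R n) (k : R) (x : sphere R n) : R :=
  (fvml_const n.+1 k * expR (k * dotp (sphere_val mu) (sphere_val x)))%R.

Definition fvml (mu : sphere R n) (k : R) (A : set (sphere R n)) : \bar R :=
  \int[surface_measure]_(x in A) (fvml_density mu k x)%:E.

End fvml.

Section power_measure.
Context d {T : measurableType d} {R : realType}.
Local Open Scope ereal_scope.

(* N-fold product measure, on the product sigma-algebra of N.-tuple T. *)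
Fixpoint power_measure (P : set T -> \bar R) (N : nat) :
    set (N.-tuple T) -> \bar R :=
  if N is N'.+1 then
    pushforward (P \x @power_measure P N')
      (fun xt : T * N'.-tuple T => [tuple of xt.1 :: xt.2])
  else \d_[tuple].

End power_measure.

Arguments power_measure {d T R} P N.

(* Main.v *)
Require Import Defs.
From HB Require Import structures.
From mathcomp Require Import all_boot all_order all_algebra.
From mathcomp Require Import all_classical all_reals all_analysis.
From mathcomp Require Import measurable_realfun ring lra zify.

(** Write F(t) for the integral of khat(x) exp(t mu.(x_1 + ... + x_N)) against
    the N-th power of the surface measure.  Unbiasedness at (mu, kappa) and at
    (- mu, kappa) says that F(kappa) = F(- kappa) = kappa h(kappa)^N, where
    h = 1 / C_n is, up to a constant, the power series of kappa^(-nu) I_nu(kappa),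
    hence nondecreasing and bounded below by some c > 0: it grows linearly at 0.
    But F is smooth, so that F(2t) + F(-2t) - F(t) - F(-t) = O(t^2), while this
    difference is 4 t h(2t)^N - 2 t h(t)^N >= 2 t c^N, a contradiction.
    That C_n is the normalizing constant is never needed; what is needed is that
    the surface measure is a finite measure, which follows from Caratheodory's
    criterion for metric outer measures and from explicit covers. *)

Set Implicit Arguments.
Unset Strict Implicit.
Unset Printing Implicit Defensive.

Import Order.TTheory GRing.Theory Num.Theory.
Import numFieldTopology.Exports numFieldNormedType.Exports.

Local Open Scope classical_set_scope.
Local Open Scope ring_scope.

(** * Hausdorff measure *)

Section metric_outer_measure.
Context {R : realType} {T : pseudoMetricType R} (mu : {outer_measure set T -> \bar R}).
Local Open Scope ereal_scope.
Hypothesis mu_metric : forall (A B : set T) (e : R), (0 < e)%R ->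
  (forall x y, A x -> B y -> ~ ball x e y) -> mu A + mu B <= mu (A `|` B).

Lemma open_caratheodory (U : set T) : open U -> mu.-caratheodory U.
Proof.
move=> oU; apply: le_caratheodory_measurable => A.
have [->|muA] := eqVneq (mu A) +oo; first by rewrite leey.
have muAfin : mu A < +oo by rewrite ltey.
pose r k : R := (k.+1%:R^-1)%R.
have r0 k : (0 < r k)%R by rewrite invr_gt0.
have rS k : (r k.+1 < r k)%R by rewrite ltf_pV2 ?posrE// ltr_nat.
(* F k is the set of points 1/(k+1)-far from the complement of U.  The layers
   D k and D (k + 2) are separated, so that the sum of the mu (D k) is at most
   2 mu A (up to D 0) and its tails vanish. *)
pose F k := [set x | forall y, ~ U y -> ~ ball x (r k) y].
have FS k : F k `<=` F k.+1.
  move=> x Fx y Uy bxy; apply: (Fx y Uy).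
  exact: (le_ball (ltW (rS k))).
have FU k : F k `<=` U.
  move=> x Fx; apply: contrapT => Ux; apply: (Fx x Ux); exact: ballxx.
have UF x : U x -> exists k, F k x.
  move=> Ux; move: oU; rewrite openE => /(_ x Ux).
  rewrite /interior => /nbhs_ballP[e/= e0 eU].
  have [k _ ke] := near_infty_natSinv_lt (PosNum e0).
  exists k => y Uy bxy; apply: Uy; apply: eU.
  by apply: le_ball bxy; apply/ltW; exact: (ke k (leqnn k)).
(* A point y outside [F k.+1] is within [r k.+1] of some z outside [U]; by the triangle inequality,
   a point of [F k] too close to y would be within [r k] of z. *)
have sepF k x y : F k x -> ~ F k.+1 y -> ~ ball x (r k - r k.+1)%R y.
  move=> Fx /existsNP[z /not_implyP[Uz /contrapT byz]] bxy.
  apply: (Fx z Uz); rewrite -(subrK (r k.+1) (r k)).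
  exact: ball_triangle bxy byz.
pose D k := A `&` (F k.+1 `\` F k).
have stepD k : mu (A `&` F k) + mu (D k.+1) <= mu (A `&` F k.+2).
  apply: (@le_trans _ _ (mu ((A `&` F k) `|` D k.+1))).
    apply: (@mu_metric _ _ (r k - r k.+1)%R); first by rewrite subr_gt0.
    by move=> x y [_ Fx] [_ [_ Fy]]; exact: sepF.
  apply: le_outer_measure => x [[Ax Fx]|[Ax [Fx _]]]; split => //.
  exact/FS/FS.
(* Layers are added two at a time: by [stepD], those of odd index are absorbed in the first term on
   the right, those of even index in the second. *)
have sumD n : \sum_(0 <= j < n.*2) mu (D j.+1) <=
    mu (A `&` F n.*2) + mu (A `&` F n.*2.+1).
  elim: n => [|n IH]; first by rewrite big_nil adde_ge0// outer_measure_ge0.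
  rewrite doubleS !big_nat_recr//=.
  apply: (@le_trans _ _ (mu (A `&` F n.*2) + mu (D n.*2.+1) +
     (mu (A `&` F n.*2.+1) + mu (D n.*2.+2)))).
    rewrite -[leLHS]/(\sum_(0 <= j < n.*2) mu (D j.+1) + mu (D n.*2.+1) +
      mu (D n.*2.+2)) -[leLHS]addeA [leRHS]addeACA.
    by apply: leeD; [exact: IH | exact: lexx].
  by apply: leeD; exact: stepD.
have sumD2 n : \sum_(0 <= j < n) mu (D j.+1) <= mu A + mu A.
  apply: (@le_trans _ _ (\sum_(0 <= j < n.*2) mu (D j.+1))).
    apply: lee_sum_nneg_natr => [? _ _|]; first exact: outer_measure_ge0.
    by rewrite -addnn leq_addr.
  apply: (le_trans (sumD n)).
  by apply: leeD; apply: le_outer_measure => x [].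
have sumDoo : \sum_(0 <= j <oo) mu (D j) < +oo.
  have D0 k : 0 <= mu (D k) by exact: outer_measure_ge0.
  rewrite (nneseries_recl (P := xpredT) (f := mu \o D) (fun k _ => D0 k))//.
  apply: lte_add_pinfty => /=.
    by apply: le_lt_trans muAfin; apply: le_outer_measure => x [].
  rewrite -(nneseries_addn (f := mu \o D) 1)//.
  apply: (@le_lt_trans _ _ (mu A + mu A)); last by apply: lte_add_pinfty; exact: muAfin.
  apply: lime_le; first by apply: is_cvg_nneseries => *; exact: D0.
  apply: nearW => n; under eq_bigr do rewrite addn1; exact: sumD2.
have tail0 := nneseries_tail_cvg sumDoo (fun k _ => outer_measure_ge0 mu (D k)).
(* The part of [A] in [U] is covered by its part in [F k] and the layers from [D k] on. Since [F k]
   is far from the complement of [U], metric additivity applies, at the cost of a tail that vanishes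
   as k grows. *)
have key k : mu (A `&` U) + mu (A `&` ~` U) <=
    mu A + \sum_(k <= j <oo) mu (D j).
  apply: (@le_trans _ _ (mu (A `&` F k) + mu (A `&` ~` U) +
      \sum_(k <= j <oo) mu (D j))); last first.
    rewrite leeD2r//.
    apply: (@le_trans _ _ (mu ((A `&` F k) `|` (A `&` ~` U)))).
      apply: (@mu_metric _ _ (r k)) => // x y [_ Fx] [_ Uy]; exact: Fx.
    by apply: le_outer_measure => x [] [].
  rewrite addeAC leeD2r//.
  apply: (@le_trans _ _ (mu (A `&` F k) + mu (\bigcup_(j in ~` `I_k) D j))).
    apply: le_trans (outer_measureU2 _ _ _).
    apply: le_outer_measure => x [Ax Ux].
    have [|nFkx] := pselect (F k x); first by left.
    right; have exP : exists j, `[<F j x>].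
      by have [j Fj] := UF x Ux; exists j; exact/asboolP.
    case: (ex_minnP exP) => m /asboolP Fm minm.
    have km : (k < m)%N.
      rewrite ltnNge; apply/negP => mk; apply: nFkx; move: Fm.
      rewrite -(subnK mk); elim: (k - m)%N => // p IH Fm; exact/FS/IH.
    case: m => // m in Fm minm km *.
    exists m; first by rewrite /= ltnNge -ltnS km.
    do 2 split => //; move=> Fmx; have := minm m (asboolT Fmx).
    by rewrite ltnn.
  by rewrite leeD2l//; exact: outer_measure_sigma_subadditive_tail.
rewrite -[leRHS]adde0; apply: (@cvge_to_ge _ \oo _ _
  (fun k => mu A + \sum_(k <= j <oo) mu (D j))); last exact: nearW.
by apply: cvgeD => //; [rewrite fin_num_adde_defl|exact: cvg_cst].
Qed.
End metric_outer_measure.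

Lemma Gamma_ge0 (R : realType) (x : R) : 0 <= Gamma x.
Proof.
by apply: Rintegral_ge0 => t _; rewrite mulr_ge0 ?powR_ge0 ?expR_ge0.
Qed.

Lemma ball_volume_ge0 (R : realType) d : 0 <= ball_volume d :> R.
Proof. by rewrite divr_ge0 ?powR_ge0// mulr_ge0 ?exprn_ge0 ?Gamma_ge0. Qed.

(** * The Hausdorff measure is a metric outer measure *)

Section hausdorff_outer_measure.
Context {R : realType} {n : nat}.
Local Open Scope ereal_scope.
Implicit Types (A B : set 'rV[R]_n) (d : nat).

Lemma enorm0 : enorm (0 : 'rV[R]_n) = 0%R.
Proof.
by rewrite /enorm /dotp big1 ?sqrtr0// => i _; rewrite mxE mulr0.
Qed.

Lemma coord_le_enorm (x : 'rV[R]_n) i : (`|x 0%R i| <= enorm x)%R.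
Proof.
rewrite -sqrtr_sqr ler_sqrt; last by apply: sumr_ge0 => j _; rewrite -expr2 sqr_ge0.
rewrite /dotp (bigD1 i)//= -expr2 lerDl.
by apply: sumr_ge0 => j _; rewrite -expr2 sqr_ge0.
Qed.

Lemma diam_ge0 A : A !=set0 -> 0 <= diam A.
Proof.
move=> [x Ax]; apply: ereal_sup_ubound; exists (x, x) => //=.
by rewrite subrr enorm0.
Qed.

Lemma hausdorff_gauge0 d : hausdorff_gauge d (set0 : set 'rV[R]_n) = 0.
Proof. by rewrite /hausdorff_gauge eqxx. Qed.

Lemma hausdorff_gauge_ge0 d A : 0 <= hausdorff_gauge d A.
Proof.
rewrite /hausdorff_gauge; case: ifPn => // /set0P A0.
by rewrite mule_ge0 ?lee_fin ?ball_volume_ge0// expe_ge0// diam_ge0.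
Qed.

Lemma diam_set0 : diam (set0 : set 'rV[R]_n) = -oo.
Proof.
rewrite /diam (_ : [set _ | _ in _] = set0) ?ereal_sup0//.
by apply/seteqP; split => // _ [[x y] [[]]].
Qed.

(** The bound on the diameters of a cover is moved into the gauge as the value +oo, so that the
    content becomes the outer extension of a single set function. *)
Definition small_gauge d (delta : R) (A : set 'rV[R]_n) : \bar R :=
  if diam A <= delta%:E then hausdorff_gauge d A else +oo.

(* Covers by arbitrary sets become measurable covers for the discrete
   sigma-algebra, so that the library's outer measures apply. *)
Lemma hausdorff_contentE d (delta : R) A : (0 < delta)%R ->
  hausdorff_content d delta A =
  @mu_ext _ (g_sigma_algebraType [set: set 'rV[R]_n]) R
    (small_gauge d delta) A.
Proof.
move=> d0; apply/eqP; rewrite eq_le; apply/andP; split.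
- apply: le_ereal_inf_tmp => _ [U [mU AU] <-].
  have [Ud|/existsNP[i Ui]] := pselect (forall i, diam (U i) <= delta%:E).
    apply: ereal_inf_lbound; exists U => //.
    by apply: eq_eseriesr => i _; rewrite /small_gauge Ud.
  (* A cover with a member of too large a diameter has infinite total gauge, hence does not lower
     the infimum. *)
  rewrite (@eseries_pinfty _ _ xpredT i) ?leey//.
    move=> j _; rewrite /small_gauge; case: ifP => // _.
    by rewrite gt_eqF// (lt_le_trans _ (hausdorff_gauge_ge0 _ _))// ltNyr.
  by rewrite /small_gauge; case: ifP.
- apply: le_ereal_inf_tmp => _ [U [AU Ud] <-].
  apply: ereal_inf_lbound; exists U.
    by split => // i; exact: sub_sigma_algebra.
  by apply: eq_eseriesr => i _; rewrite /small_gauge Ud.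
Qed.

Lemma small_gauge0 d (delta : R) : small_gauge d delta set0 = 0.
Proof. by rewrite /small_gauge diam_set0 leNye hausdorff_gauge0. Qed.

Lemma small_gauge_ge0 d (delta : R) A : 0 <= small_gauge d delta A.
Proof. by rewrite /small_gauge; case: ifP => // _; exact: hausdorff_gauge_ge0. Qed.

Lemma hausdorff_content_ge0 d (delta : R) A : 0 <= hausdorff_content d delta A.
Proof.
apply: le_ereal_inf_tmp => _ [U _ <-].
by apply: nneseries_ge0 => *; exact: hausdorff_gauge_ge0.
Qed.

Lemma hausdorff_content_le d (delta : R) A : (0 < delta)%R ->
  hausdorff_content d delta A <= hausdorff d A.
Proof. by move=> d0; apply: ereal_sup_ubound; exists delta. Qed.

Lemma hausdorff0 d : hausdorff d (set0 : set 'rV[R]_n) = 0.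
Proof.
apply/eqP; rewrite eq_le; apply/andP; split.
  apply: ge_ereal_sup => _ [delta d0 <-].
  by rewrite hausdorff_contentE// mu_ext0//; [exact: small_gauge0|exact: small_gauge_ge0].
by apply: le_trans (hausdorff_content_le _ _ (@ltr01 R)); exact: hausdorff_content_ge0.
Qed.

Lemma hausdorff_ge0 d A : 0 <= hausdorff d A.
Proof.
by apply: le_trans (hausdorff_content_le _ _ (@ltr01 R)); exact: hausdorff_content_ge0.
Qed.

Lemma le_hausdorff d : {homo @hausdorff R n d : A B / A `<=` B >-> A <= B}.
Proof.
move=> A B AB; apply: ge_ereal_sup => _ [delta d0 <-].
apply: le_trans (hausdorff_content_le _ _ d0).
by rewrite !hausdorff_contentE//; exact: le_mu_ext.
Qed.

(** Each content is countably subadditive, being an outer extension, and the property passes to the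
    supremum over [delta]. *)
Lemma hausdorff_sigma_subadditive d : sigma_subadditive (@hausdorff R n d).
Proof.
move=> F; apply: ge_ereal_sup => _ [delta d0 <-].
rewrite hausdorff_contentE//.
apply: (le_trans (@mu_ext_sigma_subadditive _ (g_sigma_algebraType
  [set: set 'rV[R]_n]) _ _ (small_gauge_ge0 d delta) F)).
apply: lee_nneseries => [? ? ?|i _].
  by apply: mu_ext_ge0; exact: small_gauge_ge0.
by rewrite -hausdorff_contentE//; exact: hausdorff_content_le.
Qed.

HB.instance Definition _ d := isOuterMeasure.Build R 'rV[R]_n (@hausdorff R n d)
  (hausdorff0 d) (hausdorff_ge0 d) (@le_hausdorff d) (@hausdorff_sigma_subadditive d).

Lemma le_hausdorff_content d (delta1 delta2 : R) A : (delta1 <= delta2)%R ->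
  hausdorff_content d delta2 A <= hausdorff_content d delta1 A.
Proof.
move=> d12; apply: ereal_inf_le_tmp => _ [U [AU Ud] <-].
exists U => //; split => // i; apply: le_trans (Ud i) _.
by rewrite lee_fin.
Qed.

(** A set of diameter at most [delta] cannot meet both [A] and [B], so a cover of the union splits
    into a cover of each; members that miss the set are replaced by [set0], whose gauge is 0. *)
Lemma hausdorff_content_metric d (A B : set 'rV[R]_n) (delta : R) :
  (forall x y, A x -> B y -> (delta < enorm (x - y))%R) ->
  hausdorff_content d delta A + hausdorff_content d delta B <=
  hausdorff_content d delta (A `|` B).
Proof.
move=> AB; apply: le_ereal_inf_tmp => _ [U [ABU Ud] <-].
pose V C i := if pselect (U i `&` C !=set0) then U i else set0.
have coverV C : C `<=` A `|` B -> C `<=` \bigcup_i V C i.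
  move=> CAB x Cx; have [i _ Uix] := ABU _ (CAB _ Cx); exists i => //.
  by rewrite /V; case: pselect => // -[]; exists x.
have diamV C i : diam (V C i) <= delta%:E.
  by rewrite /V; case: pselect => [a|a]; rewrite ?diam_set0 ?leNye // Ud.
apply: (@le_trans _ _ (\sum_(0 <= i <oo) hausdorff_gauge d (V A i) +
   \sum_(0 <= i <oo) hausdorff_gauge d (V B i))).
  apply: leeD; apply: ereal_inf_lbound.
    by exists (V A) => //; split => //; apply: coverV => x; left.
  by exists (V B) => //; split => //; apply: coverV => x; right.
rewrite -nneseriesD; [|by move=> ? ? ?; exact: hausdorff_gauge_ge0..].
apply: lee_nneseries => [? ? ?|i _].
  by rewrite adde_ge0// hausdorff_gauge_ge0.
rewrite /V; case: pselect => [[x [Ux Ax]]|?]; case: pselect => [[y [Uy By]]|?];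
  rewrite /= ?hausdorff_gauge0 ?adde0 ?add0e ?hausdorff_gauge_ge0//.
have := AB _ _ Ax By; rewrite ltNge -lee_fin => /negP[].
by apply: le_trans (Ud i); apply: ereal_sup_ubound; exists (x, y).
Qed.

Lemma hausdorff_metric d (A B : set 'rV[R]_n) (e : R) : (0 < e)%R ->
  (forall x y, A x -> B y -> ~ ball x e y) ->
  hausdorff d A + hausdorff d B <= hausdorff d (A `|` B).
Proof.
move=> e0 AB.
(* Balls here are those of the sup norm, which the Euclidean norm dominates; halving e supplies the
   strict inequality that [ball] asks for. *)
have sep x y : A x -> B y -> (e / 2 < enorm (x - y)%R)%R.
  move=> Ax By; rewrite ltNge; apply/negP => xye; apply: (AB _ _ Ax By); split => // i j.
  rewrite (ord1 i); apply: (@le_lt_trans _ _ (e / 2)%R).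
    by apply: le_trans xye; have := coord_le_enorm (x - y) j; rewrite !mxE.
  by rewrite ltr_pdivrMr// ltr_pMr// ltr1n.
have [->|Hoo] := eqVneq (hausdorff d (A `|` B)) +oo; first by rewrite leey.
have fin C : C `<=` A `|` B -> hausdorff d C \is a fin_num.
  move=> CAB; rewrite ge0_fin_numE ?hausdorff_ge0//.
  by rewrite (le_lt_trans (le_hausdorff _ CAB))// ltey.
have fA : hausdorff d A \is a fin_num by apply: fin => x; left.
have fB : hausdorff d B \is a fin_num by apply: fin => x; right.
rewrite -leeBrDr//; apply: ge_ereal_sup => _ [d1 d10 <-].
have fA1 : hausdorff_content d d1 A \is a fin_num.
  rewrite ge0_fin_numE ?hausdorff_content_ge0//.
  by rewrite (le_lt_trans (hausdorff_content_le _ _ d10))// ltey_eq fA.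
rewrite leeBrDr// addeC -leeBrDr//; apply: ge_ereal_sup => _ [d2 d20 <-].
rewrite leeBrDr// addeC.
(* The two suprema are approached at scales [d1] and [d2]. Contents grow as the scale shrinks, so
   both may be compared at a common scale not exceeding the separation. *)
pose delta := Num.min (Num.min d1 d2) (e / 2)%R.
have delta0 : (0 < delta)%R by rewrite !lt_min d10 d20 divr_gt0.
apply: (@le_trans _ _ (hausdorff_content d delta A + hausdorff_content d delta B)).
  by apply: leeD; apply: le_hausdorff_content; rewrite !ge_min ?lexx ?orbT.
apply: le_trans (hausdorff_content_le _ _ delta0).
apply: hausdorff_content_metric => x y Ax By.
by apply: le_lt_trans (sep _ _ Ax By); rewrite ge_min lexx orbT.
Qed.

End hausdorff_outer_measure.

(** * The surface measure is a measure on the Borel sets of the sphere *)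

Section surface_measure_instance.
Context {R : realType} {n : nat}.
Local Open Scope ereal_scope.
Local Notation sm := (@surface_measure R n).

Lemma surface_measure0 : sm set0 = 0.
Proof. by rewrite /surface_measure image_set0 hausdorff0. Qed.

Lemma surface_measure_ge0 A : 0 <= sm A.
Proof. exact: hausdorff_ge0. Qed.

Lemma le_surface_measure : {homo sm : A B / A `<=` B >-> A <= B}.
Proof. by move=> A B AB; apply: le_hausdorff; exact: image_subset. Qed.

Lemma surface_measure_sigma_subadditive : sigma_subadditive sm.
Proof.
move=> F; rewrite /surface_measure image_bigcup.
exact: hausdorff_sigma_subadditive.
Qed.

HB.instance Definition _ := isOuterMeasure.Build R (sphere R n) sm
  surface_measure0 surface_measure_ge0 le_surface_measure
  surface_measure_sigma_subadditive.

(** Caratheodory sets form a sigma-algebra, so open sets suffice; these are traces of open sets of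
    the ambient space, where the metric criterion applies. *)
Lemma surface_measure_caratheodory (A : set (sphere R n)) :
  measurable A -> sm.-caratheodory A.
Proof.
apply: smallest_sub.
  split.
  - exact: caratheodory_measurable_set0.
  - by move=> B mB; rewrite setTD; exact: caratheodory_measurable_setC.
  - exact: caratheodory_measurable_bigcup.
move=> _ [U oU <-] X.
have := @open_caratheodory R _ (@hausdorff R n.+1 n) (@hausdorff_metric R n.+1 n)
  U oU (sphere_val @` X).
rewrite /surface_measure => ->; congr (_ + _); congr hausdorff.
- apply/seteqP; split => [_ [[x Xx <-] Ux]|_ [x [Xx Ux] <-]]; first by exists x.
  by split => //; exists x.
- apply/seteqP; split => [_ [[x Xx <-] Ux]|_ [x [Xx Ux] <-]]; first by exists x.
  by split => //; exists x.
Qed.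

Lemma surface_measure_semi_sigma_additive : semi_sigma_additive sm.
Proof.
move=> F mF tF mUF; apply: caratheodory_measure_sigma_additive => //.
- by move=> i; exact: surface_measure_caratheodory.
- exact: surface_measure_caratheodory.
Qed.

HB.instance Definition _ := isMeasure.Build _ (sphere R n) R sm
  surface_measure0 surface_measure_ge0 surface_measure_semi_sigma_additive.

End surface_measure_instance.

(** * The sphere has finite Hausdorff measure *)

Section sphere_cover.
Context {R : realType}.

(** The finite cover is enumerated and padded with [set0], which has diameter -oo and gauge 0. *)
Lemma hausdorff_content_finite_cover n d (delta : R) (A : set 'rV[R]_n)
    (I : finType) (U : I -> set 'rV[R]_n) :
  A `<=` \bigcup_i U i -> (forall i, diam (U i) <= delta%:E)%E ->
  (hausdorff_content d delta A <= \sum_(i : I) hausdorff_gauge d (U i))%E.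
Proof.
move=> AU Ud; pose s := [seq U i | i <- enum I].
have sI : size s = #|I| by rewrite size_map -cardE.
apply: (@le_trans _ _ (\sum_(0 <= k <oo) hausdorff_gauge d (nth set0 s k))%E).
  apply: ereal_inf_lbound; exists (nth set0 s) => //; split.
    move=> x /AU[i _ Ux]; exists (enum_rank i) => //.
    by rewrite (nth_map i) ?nth_enum_rank// -cardE ltn_ord.
  move=> k; have [ks|ks] := ltnP k (size s); last first.
    by rewrite nth_default// diam_set0 leNye.
  rewrite sI in ks; have i0 : I by exact: (enum_val (Ordinal ks)).
  by rewrite (nth_map i0) -?cardE.
rewrite (nneseries_split 0 #|I|); last by move=> *; exact: hausdorff_gauge_ge0.
rewrite add0n [X in (_ + X)%E]eseries0 ?adde0; last first.
  by move=> k kI _; rewrite nth_default ?hausdorff_gauge0// sI.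
by rewrite -sI -(big_nth set0 xpredT) big_map big_enum.
Qed.

Context {n : nat}.
Local Notation p := (n.+1%:R : R).

(* One coordinate, in absolute value at least 1/p, is a Lipschitz function of the
   others, which lie in a grid of mesh 1/m: there are O(m^n) cells, of diameter
   O(1/m). *)
Definition sphere_cell (m : nat) (t : 'I_n.+1 * bool * {ffun 'I_n -> 'I_(m.*2.+1)}) :
    set 'rV[R]_n.+1 :=
  [set x | [/\ enorm x = 1, p^-1 <= (-1) ^+ t.1.2 * x 0 t.1.1 &
    forall j, Num.truncn (m%:R * (x 0 (lift t.1.1 j) + 1)) = t.2 j :> nat]].

Lemma enorm1_dotp (x : 'rV[R]_n.+1) : enorm x = 1 -> dotp x x = 1.
Proof.
move=> x1; have : 0 <= dotp x x by apply: sumr_ge0 => i _; rewrite -expr2 sqr_ge0.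
by move/sqr_sqrtr => <-; rewrite -/(enorm x) x1 expr1n.
Qed.

Lemma sphere_cell_cover (m : nat) :
  (0 < m)%N -> @unit_sphere R n `<=` \bigcup_t @sphere_cell m t.
Proof.
move=> m0 x x1.
have x_le1 j : `|x 0 j| <= 1 by rewrite -x1 coord_le_enorm.
(* Otherwise each of the p squares would be at most the absolute value of its coordinate, hence less
   than 1/p, and they would sum to less than 1. *)
have [i xi] : exists i, p^-1 <= `|x 0 i|.
  apply: contrapT => /forallNP xp.
  have : dotp x x < 1; last by rewrite enorm1_dotp// ltxx.
  apply: (@lt_le_trans _ _ (\sum_(i < n.+1) p^-1)); last first.
    by rewrite sumr_const card_ord -[_ *+ _]mulr_natr mulVf// pnatr_eq0.
  apply: ltr_sum => [|i _]; first by apply/hasP; exists ord0; rewrite ?mem_index_enum.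
  have xip : `|x 0 i| < p^-1 by rewrite ltNge; apply/negP.
  rewrite -expr2 -real_normK ?num_real// expr2.
  by apply: le_lt_trans xip; rewrite ler_piMr.
(* Coordinates lie in [-1, 1], so the truncated number lies in [0, 2m]; this gives the 2m + 1 grid
   positions. *)
have trm j : (Num.truncn (m%:R * (x 0 j + 1))%R < m.*2.+1)%N.
  have := x_le1 j; rewrite ler_norml => /andP[x1' x2].
  rewrite ltnS truncn_le_nat.
  rewrite -[m.*2.+1%:R]natr1 -mul2n natrM.
  have m1 : 0 <= (m%:R : R) by [].
  nra.
exists (i, x 0 i < 0, [ffun j => Ordinal (trm (lift i j))]) => //; split => //=.
  by rewrite -normrEsign.
by move=> j; rewrite ffunE.
Qed.

(** Coordinates other than i differ by at most 1/m. For the i-th, the equation of the sphere makes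
    (x_i - y_i)(x_i + y_i) a sum of n terms of size at most 2/m, while x_i and y_i share a sign, so
    that their sum has absolute value at least 2/p. Each coordinate thus moves by at most p^2/m. *)
Lemma diam_sphere_cell (m : nat) t : (0 < m)%N ->
  (diam (@sphere_cell m t) <= (p ^+ 3 / m%:R)%:E)%E.
Proof.
case: t => [[i s] k] m0; apply: ge_ereal_sup => _ [[x y] [[/= x1 xi xk] [y1 yi yk]] <-].
rewrite lee_fin /=.
have m0' : 0 < (m%:R : R) by rewrite ltr0n.
have le1 (z : 'rV[R]_n.+1) j : enorm z = 1 -> `|z 0 j| <= 1.
  by move=> <-; exact: coord_le_enorm.
have xy j : `|x 0 (lift i j) - y 0 (lift i j)| <= m%:R^-1.
  have [tx ty] := (xk j, yk j); set X := x _ _; set Y := y _ _.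
  have ge0 (a : R) : `|a| <= 1 -> 0 <= m%:R * (a + 1).
    by rewrite ler_norml => /andP[a1 _]; rewrite mulr_ge0// -lerBlDr sub0r.
  have := Num.Theory.truncn_itv (ge0 _ (le1 _ (lift i j) x1)).
  have := Num.Theory.truncn_itv (ge0 _ (le1 _ (lift i j) y1)).
  rewrite -/X -/Y tx ty -natr1 => /andP[Y1 Y2] /andP[X1 X2].
  rewrite -[leRHS]mul1r ler_pdivlMr// -[m%:R]ger0_norm// -normrM ler_norml.
  by apply/andP; split; lra.
have xyi : `|x 0 i - y 0 i| <= p ^+ 2 / m%:R.
  have : (x 0 i - y 0 i) * (x 0 i + y 0 i) =
     \sum_(j < n) (y 0 (lift i j) - x 0 (lift i j)) * (y 0 (lift i j) + x 0 (lift i j)).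
    have := enorm1_dotp x1; have := enorm1_dotp y1; rewrite /dotp !(bigD1_ord i)//=.
    rewrite [in X in _ -> _ -> _ = X](eq_bigr (fun j => y 0 (lift i j) * y 0 (lift i j) -
      x 0 (lift i j) * x 0 (lift i j))) => [|j _]; last by ring.
    rewrite sumrB; lra.
  move=> /(congr1 Num.norm); rewrite normrM => xyE.
  have : `|x 0 i - y 0 i| * `|x 0 i + y 0 i| <= n%:R * (2 * m%:R^-1).
    rewrite xyE; apply: le_trans (ler_norm_sum _ _ _) _.
    rewrite -[n in n%:R * _]card_ord mulr_natl -sumr_const; apply: ler_sum => j _.
    rewrite normrM mulrC distrC; apply: ler_pM => //.
    apply: le_trans (ler_normD _ _) _.
    by rewrite (natrD _ 1 1) lerD// le1.
  have : 2 * p^-1 <= `|x 0 i + y 0 i|.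
    rewrite -[leRHS](normrMsign s) mulrDr.
    by apply: le_trans (ler_norm _); rewrite mulr2n mulrDl mul1r lerD.
  move=> lo hi; have p0 : 0 < p by [].
  have p20 : 0 < 2 * p^-1 by rewrite mulr_gt0// invr_gt0.
  rewrite -(ler_pM2r p20); apply: (@le_trans _ _ (n%:R * (2 * m%:R^-1))).
    by apply: le_trans hi; exact: ler_wpM2l.
  rewrite (_ : p ^+ 2 / m%:R * (2 * p^-1) = p * (2 * m%:R^-1)); last first.
    by field; rewrite gt_eqF //= gt_eqF.
  by rewrite ler_wpM2r ?ler_nat// mulr_ge0// invr_ge0.
have xyj j : `|x 0 j - y 0 j| <= p ^+ 2 / m%:R.
  case: (unliftP i j) => [j' ->|->//].
  apply: le_trans (xy j') _; rewrite ler_peMl ?invr_ge0 ?ler0n//.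
  by rewrite exprn_ege1// ler1n.
rewrite -[leRHS]ger0_norm ?divr_ge0 ?exprn_ge0// -sqrtr_sqr ler_sqrt ?sqr_ge0//.
apply: (@le_trans _ _ (\sum_(j < n.+1) (p ^+ 2 / m%:R) ^+ 2)).
  apply: ler_sum => j _; rewrite !mxE -expr2 -real_normK ?num_real//.
  by rewrite ler_pXn2r ?nnegrE ?divr_ge0 ?exprn_ge0.
rewrite sumr_const card_ord -[leLHS]mulr_natl.

rewrite (_ : (p ^+ 3 / m%:R) ^+ 2 = p * (p * (p ^+ 2 / m%:R) ^+ 2)); last by ring.
by rewrite ler_peMl ?ler1n// mulr_ge0// sqr_ge0.
Qed.

Lemma hausdorff_unit_sphere_lty : (hausdorff n (@unit_sphere R n) < +oo)%E.
Proof.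
(* There are 2p choices of a coordinate and a sign, and (2m + 1)^n <= (3m)^n grid positions, each of
   gauge at most [ball_volume n] times (p^3/m)^n: the powers of m cancel, and [K] does not depend on
   [delta]. *)
pose K : R := (n.+1 * 2)%:R * 3 ^+ n * (ball_volume n * (p ^+ 3) ^+ n).
apply: (@le_lt_trans _ _ K%:E); last exact: ltry.
apply: ge_ereal_sup => _ [delta /= d0 <-].
have [m m0 mdelta] : exists2 m, (0 < m)%N & p ^+ 3 / m%:R <= delta.
  exists (Num.truncn (p ^+ 3 / delta)).+1 => //.
  rewrite ler_pdivrMr ?ltr0n// mulrC -ler_pdivrMr//.
  by apply/ltW; exact: Num.Theory.truncnS_gt.
apply: le_trans (le_hausdorff_content _ _ mdelta) _.
apply: le_trans (hausdorff_content_finite_cover _ (sphere_cell_cover m0)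
  (fun t => diam_sphere_cell t m0)) _.
apply: (@le_trans _ _ (\sum_(t : 'I_n.+1 * bool * {ffun 'I_n -> 'I_(m.*2.+1)})
   (ball_volume n * (p ^+ 3 / m%:R) ^+ n)%:E)%E).
  apply: lee_sum => t _; rewrite /hausdorff_gauge; case: ifPn => [_|/set0P t0].
    by rewrite lee_fin mulr_ge0 ?ball_volume_ge0// exprn_ge0// divr_ge0 ?exprn_ge0.
  rewrite [leRHS]EFinM lee_wpmul2l ?lee_fin ?ball_volume_ge0//.
  have := diam_ge0 t0; have := diam_sphere_cell t m0.
  case: (diam _) => [r| |]//; rewrite !lee_fin => rm r0.
  by rewrite -EFin_expe lee_fin lerXn2r ?nnegrE// (le_trans r0).
rewrite sumEFin lee_fin sumr_const !card_prod card_ord card_bool card_ffun !card_ord.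
rewrite -[leLHS]mulr_natl /K !natrM natrX.
have m0' : 0 < (m%:R : R) by rewrite ltr0n.
rewrite expr_div_n mulrACA [leLHS](_ : _ = n.+1%:R * 2 * (ball_volume n * (p ^+ 3) ^+ n) *
   (m.*2.+1%:R ^+ n / m%:R ^+ n)); last by ring.
rewrite [leRHS](_ : _ = n.+1%:R * 2 * (ball_volume n * (p ^+ 3) ^+ n) * 3 ^+ n); last by ring.
apply: ler_wpM2l.
  apply: mulr_ge0; first exact: mulr_ge0.
  by apply: mulr_ge0; [exact: ball_volume_ge0|do 2 apply: exprn_ge0].
rewrite -expr_div_n lerXn2r ?nnegrE ?divr_ge0//.
by rewrite ler_pdivrMr// -natrM ler_nat; lia.
Qed.

End sphere_cover.

(** * Densities and powers of measures *)

Section density.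
Context d (T : measurableType d) (R : realType).
Local Open Scope ereal_scope.
Variables (m : {measure set T -> \bar R}) (p : T -> R).
Hypotheses (mp : measurable_fun [set: T] p) (p_ge0 : forall x, (0 <= p x)%R).

(** The existential form allows a bare set function such as [fvml] to be rewritten into a bundled
    finite measure. *)
Lemma density_finite_measure : \int[m]_x (p x)%:E < +oo ->
  exists P : {finite_measure set T -> \bar R},
    (P : set T -> \bar R) = (fun A => \int[m]_(x in A) (p x)%:E).
Proof.
move=> poo; pose f (A : set T) := \int[m]_(x in A) (p x)%:E.
have f0 : f set0 = 0 by rewrite /f integral_set0.
have fge0 A : 0 <= f A by apply: integral_ge0 => x _; rewrite lee_fin.
have fs : semi_sigma_additive f.
  by apply: semi_sigma_additive_nng_induced => [|x]; [exact/measurable_EFinP|rewrite lee_fin].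
have ffin : fin_num_fun f.
  move=> A mA; rewrite ge0_fin_numE//; apply: le_lt_trans poo.
  apply: ge0_subset_integral => //; first exact/measurable_EFinP.
  by move=> x _; rewrite lee_fin.
pose fm := isMeasure.Build _ T R f f0 fge0 fs.
pose fmeas : {measure set T -> \bar R} := HB.pack f fm.
pose ff := Measure_isFinite.Build _ T R fmeas ffin.
pose F : {finite_measure set T -> \bar R} := HB.pack f fm ff.
by exists F.
Qed.

Import HBNNSimple.

(** Monotone convergence reduces to simple functions, and linearity to indicators, where the claim
    is the hypothesis on [P]. *)
Lemma ge0_integral_density (P : {measure set T -> \bar R}) (f : T -> \bar R) :
  (forall A, measurable A -> P A = \int[m]_(x in A) (p x)%:E) ->
  measurable_fun [set: T] f -> (forall x, 0 <= f x) ->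
  \int[P]_x f x = \int[m]_x (f x * (p x)%:E).
Proof.
move=> PE mf f0; pose h := nnsfun_approx measurableT mf.
have mpE : measurable_fun [set: T] (EFin \o p) by exact/measurable_EFinP.
have hf x : (h n x)%:E @[n --> \oo] --> f x by exact: cvg_nnsfun_approx.
have -> : \int[P]_x f x = limn (fun n => \int[P]_x (h n x)%:E).
  rewrite -monotone_convergence//.
  - by apply: eq_integral => x _; apply/esym/cvg_lim.
  - by move=> n; apply/measurable_EFinP.
  - by move=> n x _; rewrite lee_fin.
  - by move=> x _ a b ab; rewrite lee_fin; exact/lefP/nd_nnsfun_approx.
have -> : \int[m]_x (f x * (p x)%:E) = limn (fun n => \int[m]_x ((h n x)%:E * (p x)%:E)).
  rewrite -monotone_convergence//.
  - by apply: eq_integral => x _; apply/esym/cvg_lim => //; apply: cvgeZr.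
  - by move=> n; apply: emeasurable_funM => //; exact/measurable_EFinP.
  - by move=> n x _; rewrite mule_ge0 ?lee_fin.
  - by move=> x _ a b ab; rewrite lee_wpmul2r ?lee_fin//; exact/lefP/nd_nnsfun_approx.
congr (limn _); apply/funext => n.
transitivity (\sum_(r \in range (h n)) \int[P]_x (r * \1_(h n @^-1` [set r]) x)%:E).
  rewrite -ge0_integral_fsum//; last 2 first.
  - by move=> r; exact/measurable_EFinP/measurable_funM.
  - by move=> r x _; exact: nnfun_muleindic_ge0.
  by apply: eq_integral => x _; rewrite fimfunE -fsumEFin.
transitivity (\sum_(r \in range (h n))
    \int[m]_x ((r * \1_(h n @^-1` [set r]) x)%:E * (p x)%:E)); last first.
  rewrite -ge0_integral_fsum//; last 2 first.
  - by move=> r; apply: emeasurable_funM => //; exact/measurable_EFinP/measurable_funM.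
  - by move=> r x _; apply: mule_ge0; [exact: nnfun_muleindic_ge0|rewrite lee_fin].
  apply: eq_integral => x _; rewrite -ge0_mule_fsuml => [|r]; last exact: nnfun_muleindic_ge0.
  by rewrite fsumEFin// -fimfunE.
apply: eq_fsbigr => r /[!inE] -[t _ <-].
rewrite integralZl_indic_nnsfun// integral_indic// setIT PE//.
under [RHS]eq_integral do rewrite EFinM -muleA.
rewrite ge0_integralZl//; last 3 first.
- by apply: emeasurable_funM => //; exact/measurable_EFinP.
- by move=> x _; rewrite mule_ge0// lee_fin.
- by rewrite lee_fin.
congr (_ * _); rewrite [LHS]integral_mkcond; apply: eq_integral => x _.
by rewrite epatch_indic muleC.
Qed.

End density.

(** * Powers of a finite measure and of a density *)

Section power_measure_density.
Context d (T : measurableType d) (R : realType).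
Local Open Scope ereal_scope.
Implicit Types P m : {finite_measure set T -> \bar R}.

Let cons_tuple N (xt : T * N.-tuple T) : N.+1.-tuple T := [tuple of xt.1 :: xt.2].

Lemma measurable_cons_tuple N :
  measurable_fun [set: T * N.-tuple T] (@cons_tuple N).
Proof. by apply: measurable_cons. Qed.

(** [power_measure] is a recursion on bare set functions; the induction recovers at each stage the
    finite measure that Tonelli's theorem requires. *)
Lemma power_measure_finite P N :
  exists Q : {finite_measure set (N.-tuple T) -> \bar R},
    (Q : set (N.-tuple T) -> \bar R) = power_measure P N.
Proof.
elim: N => [|N [Q QE]]; first by exists (\d_[tuple]).
rewrite /= -QE; set f := pushforward _ _.
have f0 : f set0 = 0 by rewrite /f /pushforward preimage_set0 measure0.
have fge0 A : 0 <= f A by exact: (measure_ge0 (P \x Q)%E).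
have mcons A : measurable A -> measurable (@cons_tuple N @^-1` A).
  by move=> mA; rewrite -[X in measurable X]setTI; apply: measurable_cons_tuple.
have fs : semi_sigma_additive f.
  move=> F mF tF mUF; rewrite /f /pushforward preimage_bigcup.
  apply: measure_semi_sigma_additive => [n||].
  - exact: mcons.
  - apply/trivIsetP => i j _ _ ij; rewrite -preimage_setI.
    by move/trivIsetP : tF => ->; rewrite ?preimage_set0.
  - by rewrite -preimage_bigcup; exact: mcons.
have ffin : fin_num_fun f.
  move=> A mA; rewrite ge0_fin_numE//.
  apply: (@le_lt_trans _ _ ((P \x Q) [set: T * N.-tuple T])).
    by apply: (@le_measure _ _ _ (P \x Q)%E); rewrite ?inE;
      [exact: mcons|exact: measurableT|exact: subsetT].
  rewrite -setXTT product_measure1E// -ge0_fin_numE ?mule_ge0//.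
  by rewrite fin_numM// fin_num_measure.
clearbody f.
pose fm := isMeasure.Build _ _ R f f0 fge0 fs.
pose fmeas : {measure set (N.+1.-tuple T) -> \bar R} := HB.pack f fm.
pose ff := Measure_isFinite.Build _ _ R fmeas ffin.
pose F : {finite_measure set (N.+1.-tuple T) -> \bar R} := HB.pack f fm ff.
by exists F.
Qed.

Lemma ge0_integral_power_measureS P N (f : N.+1.-tuple T -> \bar R) :
  measurable_fun [set: N.+1.-tuple T] f -> (forall x, 0 <= f x) ->
  \int[power_measure P N.+1]_x f x =
  \int[P]_x \int[power_measure P N]_t f [tuple of x :: t].
Proof.
move=> mf f0 /=; have [Q QE] := power_measure_finite P N; rewrite -QE.
rewrite (@ge0_integral_pushforward _ _ _ _ _ _ (@measurable_cons_tuple N))//.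
rewrite preimage_setT fubini_tonelli1//; last by move=> x; exact: f0.
by apply: measurableT_comp => //; exact: measurable_cons_tuple.
Qed.

Lemma ge0_integral_power_density m P (p : T -> R) :
  measurable_fun [set: T] p -> (forall x, (0 <= p x)%R) ->
  (forall A, measurable A -> P A = \int[m]_(x in A) (p x)%:E) ->
  forall N (f : N.-tuple T -> \bar R),
  measurable_fun [set: N.-tuple T] f -> (forall x, 0 <= f x) ->
  \int[power_measure P N]_x f x =
  \int[power_measure m N]_x (f x * (\prod_(i < N) p (tnth x i))%:E).
Proof.
move=> mp p0 PE; elim=> [|N IH] f mf f0.
  by apply: eq_integral => x _; rewrite big_ord0 mule1.
have mprod k : measurable_fun [set: k.-tuple T] (fun x => \prod_(i < k) p (tnth x i))%R.
  by apply: measurable_prod => i _; apply: measurableT_comp => //; exact: measurable_tnth.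
rewrite !ge0_integral_power_measureS//; last 2 first.
- by apply: emeasurable_funM; [exact: mf|apply/measurable_EFinP; exact: mprod].
- by move=> x; apply: mule_ge0 => //; rewrite lee_fin; apply: prodr_ge0 => i _; exact: p0.
have [Q QE] := power_measure_finite P N.
have [M ME] := power_measure_finite m N.
have mfc : measurable_fun [set: T * N.-tuple T] (f \o @cons_tuple N).
  by apply: measurableT_comp => //; exact: measurable_cons_tuple.
(* The first coordinate is converted from [P] to [m] while the inner integral is still against the
   power of [P]; the induction hypothesis then treats the inner integral at each fixed x. *)
rewrite -QE (@ge0_integral_density _ _ _ m p mp p0 P)//; last 2 first.
- by have := measurable_fun_fubini_tonelli_F (m2 := Q) _ mfc (fun=> f0 _).
- by move=> x; apply: integral_ge0.
apply: eq_integral => x _; rewrite QE.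
have mfx : measurable_fun [set: N.-tuple T] (fun t => f [tuple of x :: t]).
  by have := measurableT_comp mfc (pair1_measurable x).
rewrite IH// -ME -ge0_integralZr ?lee_fin//; last 2 first.
- by apply: emeasurable_funM; [exact: mfx|apply/measurable_EFinP; exact: mprod].
- by move=> t _; apply: mule_ge0 => //; rewrite lee_fin; apply: prodr_ge0 => i _; exact: p0.
apply: eq_integral => t _; rewrite big_ord_recl EFinM -muleA; congr (_ * _).
rewrite muleC tnth0; congr (_ * _%:E).
by apply: eq_bigr => i _; rewrite tnthS.
Qed.

End power_measure_density.

(** * Gamma and Bessel functions *)

Section Gamma_bounds.
Context {R : realType}.
Implicit Types x t : R.
Local Notation mu := (@lebesgue_measure R).

(* A bounded primitive whose derivative g dominates the integrand of Gamma near
   both 0 and +oo. *)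
Let G x t : R := - (1 + t `^ x)^-1.
Let g x t : R := x * t `^ (x - 1) / (1 + t `^ x) ^+ 2.

Lemma is_derive_powR_sigmoid x t : 0 < t -> is_derive t 1 (G x) (g x t).
Proof.
move=> t0; have := is_derive1_powR x t0 => d1.
have p0 : 1 + t `^ x != 0 by rewrite gt_eqF// ltr_wpDr ?powR_ge0.
have d2 : is_derive t 1 (fun u : R => 1 + u `^ x) (0 + x * t `^ (x - 1)).
  by apply: is_deriveD.
have d3 := is_deriveV (f := fun u : R => 1 + u `^ x) p0 d2.
have d4 := is_deriveN d3.
have -> : G x = - (fun u => (1 + u `^ x)^-1) by [].
apply: (is_derive_eq d4).
by rewrite /g scaleNr opprK add0r mulrC -[RHS]mulrC.
Qed.

Lemma powR_sigmoid_derive_continuous x (a b : R) : 0 < a ->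
  {within `[a, b], continuous (g x)}.
Proof.
move=> a0; apply: continuous_in_subspaceT => t; rewrite inE/= in_itv/= => /andP[at_ _].
have t0 := lt_le_trans a0 at_.
have cp y : {for t, continuous (fun u : R => u `^ y)}.
  apply: differentiable_continuous; apply/derivable1_diffP.
  by have [] := is_derive1_powR y t0.
have p0 : (1 + t `^ x) ^+ 2 != 0.
  by rewrite gt_eqF// exprn_gt0// ltr_wpDr ?powR_ge0.
apply: cvgM; first by apply: cvgM; [exact: cvg_cst|exact: cp].
apply: cvgV => //; rewrite expr2.
by under eq_fun do rewrite expr2; apply: cvgM; (apply: cvgD; [exact: cvg_cst|exact: cp]).
Qed.

(** The integral is an increment of [G x], which takes values in [-1, 0]; hence a bound uniform in
    the interval. *)
Lemma powR_sigmoid_itv x (a b : R) : 0 < a -> a < b ->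
  (\int[mu]_(t in `[a, b]) (g x t)%:E <= 1)%E.
Proof.
move=> a0 ab.
have cG t : 0 < t -> {for t, continuous (G x)}.
  move=> t0; apply: differentiable_continuous; apply/derivable1_diffP.
  by have [] := is_derive_powR_sigmoid x t0.
rewrite (@continuous_FTC2 _ _ (G x))//.
- rewrite -EFinD lee_fin /G opprK addrC.
  have : (1 + a `^ x)^-1 <= 1 by rewrite invf_le1 ?lerDl ?powR_ge0// ltr_wpDr ?powR_ge0.
  have : 0 <= (1 + b `^ x)^-1 by rewrite invr_ge0 addr_ge0 ?powR_ge0.
  lra.
- exact: powR_sigmoid_derive_continuous.
- split.
  + move=> t; rewrite in_itv/= => /andP[at_ _].
    by have [] := is_derive_powR_sigmoid x (lt_trans a0 at_).
  + by apply: cvg_at_right_filter; exact: cG.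
  + by apply: cvg_at_left_filter; apply: cG; exact: lt_trans ab.
- move=> t; rewrite in_itv/= => /andP[at_ _].
  rewrite derive1E; have d := is_derive_powR_sigmoid x (lt_trans a0 at_).
  exact: derive_val.
Qed.

Lemma powR_expR_bound x : 0 < x -> exists2 C : R, 0 <= C & forall t, 0 < t ->
  t `^ (x - 1) * expR (- t) <= C * (t `^ (x - 1) / (1 + t `^ x) ^+ 2).
Proof.
move=> x0; have [k xk] : exists k : nat, x * 2 <= k.+1%:R.
  by exists (Num.truncn (x * 2)); apply/ltW; exact: truncnS_gt.
(* With Y = t^x, (1 + Y)^2 <= 2 + 2 Y^2, where Y^2 <= 1 + t^(k+1) because 2x <= k + 1. As 1 and
   t^(k+1) are both at most (k+1)! e^t, the total is at most 6 (k+1)! e^t. *)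
exists (6 * k.+1`!%:R) => [|t t0]; first by rewrite mulr_ge0.
rewrite mulrCA ler_wpM2l ?powR_ge0//.
have tx0 := powR_ge0 t x.
rewrite ler_pdivlMr ?exprn_gt0 ?ltr_wpDr// expRN mulrC ler_pdivrMr ?expR_gt0//.
have f1 : 1 <= k.+1`!%:R :> R by rewrite ler1n fact_gt0.
have e1 := expR_ge1Dxn k (ltW t0).
have : (t `^ x) ^+ 2 <= 1 + t ^+ k.+1.
  rewrite -powR_mulrn// -powRrM; have [t1|t1] := leP t 1.
    have : t `^ (x * 2) <= 1 by rewrite -[leRHS](powRr0 t) ger_powR ?t0// mulr_ge0// ltW.
    by move/le_trans; apply; rewrite lerDl exprn_ge0// ltW.
  have : t `^ (x * 2) <= t ^+ k.+1.
    by rewrite -powR_mulrn ?(ltW t0)// ler_powR// ltW.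
  by move/le_trans; apply; rewrite lerDr.
have : t ^+ k.+1 <= k.+1`!%:R * expR t.
  rewrite mulrC -ler_pdivrMr ?(lt_le_trans ltr01)//; apply: le_trans e1.
  by rewrite lerDr.
have : 1 <= k.+1`!%:R * expR t by rewrite mulr_ege1// -expR0 ler_expR ltW.
have := sqr_ge0 (1 - t `^ x).
move: (t `^ x) (t ^+ k.+1) => Y T.
rewrite -mulrA. move: (_ * expR t) => E; rewrite !expr2; lra.
Qed.

(** A divergent integral would give [Gamma] the default value 0, so finiteness must precede any
    positive lower bound. *)
Lemma Gamma_integrand_lty x : 0 < x ->
  (\int[mu]_(t in `]0%R, +oo[) (t `^ (x - 1) * expR (- t))%:E < +oo)%E.
Proof.
move=> x0; have [C C0 CP] := powR_expR_bound x0.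
(* Starting at 2 keeps the endpoints distinct, as [powR_sigmoid_itv] requires. *)
pose F (k : nat) : set R := `[k.+2%:R^-1, k.+2%:R]%classic.
have k0 k : 0 < (k.+2%:R : R) by [].
have FE : `]0, +oo[%classic = \bigcup_k F k.
  apply/seteqP; split => t /=; rewrite in_itv/= andbT; last first.
    by move=> [k _]; rewrite /F/= in_itv/= => /andP[+ _]; apply: lt_le_trans; rewrite invr_gt0.
  move=> t0; exists (Num.truncn (t + t^-1)) => //; rewrite /F/= in_itv/=.
  have := truncnS_gt (t + t^-1); set k := Num.truncn _ => tk.
  have ti0 : 0 < t^-1 by rewrite invr_gt0.
  have kS : k.+1%:R <= (k.+2%:R : R) by rewrite ler_nat.
  by rewrite invf_ple ?posrE//; apply/andP; split; lra.
apply: (@le_lt_trans _ _ (C / x)%:E); last exact: ltry.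
have mf D : measurable_fun D (fun t : R => (t `^ (x - 1) * expR (- t))%:E).
  apply/measurable_EFinP; apply: measurable_funTS; apply: measurable_funM.
    exact: measurable_powR.
  by apply: measurableT_comp => //; exact: measurable_funN.
have mg k : measurable_fun (F k) (fun t : R => (g x t)%:E).
  apply/measurable_EFinP.
  apply: subspace_continuous_measurable_fun; first exact: measurable_itv.
  by apply: powR_sigmoid_derive_continuous; rewrite invr_gt0.
rewrite FE; apply: (@cvge_to_le _ \oo _ _ _ _ _ (ge0_nondecreasing_set_cvg_integral _ _ _ _)).
- move=> k l kl; apply/subsetPset => t; rewrite /F/= !in_itv/= => /andP[t1 t2].
  apply/andP; split; last by apply: le_trans t2 _; rewrite ler_nat.
  by apply: le_trans t1; rewrite lef_pV2 ?posrE// ler_nat.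
- by move=> k; exact: measurable_itv.
- by move=> k; exact: mf.
- by move=> k t _; rewrite lee_fin mulr_ge0 ?powR_ge0 ?expR_ge0.
apply: nearW => k.
apply: (@le_trans _ _ (\int[mu]_(t in F k) ((C / x)%:E * (g x t)%:E))%E).
  apply: ge0_le_integral => //.
  - exact: measurable_itv.
  - by move=> t _; rewrite lee_fin mulr_ge0 ?powR_ge0 ?expR_ge0.
  - exact: mf.
  - by apply: emeasurable_funM; [exact: measurable_cst|exact: mg].
  - move=> t; rewrite /F/= in_itv/= => /andP[t1 _]; rewrite -EFinM lee_fin.
    apply: le_trans (CP t _) _; first by apply: lt_le_trans t1; rewrite invr_gt0.
    rewrite le_eqVlt; apply/orP; left; apply/eqP; rewrite /g; field.
    by rewrite !gt_eqF// ltr_wpDr ?powR_ge0.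
rewrite ge0_integralZl//; [|exact: measurable_itv|exact: mg|..].
- rewrite -[leRHS]mule1 lee_wpmul2l ?lee_fin ?divr_ge0 ?(ltW x0)//.
  apply: powR_sigmoid_itv; rewrite ?invr_gt0//.
  by apply: (@lt_trans _ _ 1); rewrite ?invf_lt1 ?ltr1n.
- move=> t _; rewrite lee_fin /g divr_ge0 ?sqr_ge0// mulr_ge0 ?powR_ge0// ltW//.
- by rewrite lee_fin divr_ge0// ltW.
Qed.

(** On [1, 2] the integrand is at least e^(-2)/2, because t^(x-1) >= 1/t. The bound is uniform in x,
    which makes the Bessel series comparable to an exponential series. *)
Lemma Gamma_lower_bound x : 0 < x -> expR (- 2) / 2 <= Gamma x.
Proof.
move=> x0; rewrite -lee_fin /Gamma /Rintegral fineK; last first.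
  rewrite ge0_fin_numE; first exact: Gamma_integrand_lty.
  by apply: integral_ge0 => t _; rewrite lee_fin mulr_ge0 ?powR_ge0 ?expR_ge0.
have mf D : measurable_fun D (fun t : R => (t `^ (x - 1) * expR (- t))%:E).
  apply/measurable_EFinP; apply: measurable_funTS; apply: measurable_funM.
    exact: measurable_powR.
  by apply: measurableT_comp => //; exact: measurable_funN.
have f0 t : (0 <= (t `^ (x - 1) * expR (- t))%:E)%E.
  by rewrite lee_fin mulr_ge0 ?powR_ge0 ?expR_ge0.
have I12 : [set` `[1, 2]] `<=` [set` `]0 : R, +oo[].
  by move=> t /=; rewrite !in_itv/= andbT => /andP[t1 _]; exact: lt_le_trans t1.
apply: (@le_trans _ _ (\int[mu]_(t in `[1%R, 2%R]) (t `^ (x - 1) * expR (- t))%:E)%E);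
  last by apply: ge0_subset_integral; [exact: measurable_itv..|exact: mf| |].
apply: (@le_trans _ _ (\int[mu]_(t in `[1%R, 2%R]) (expR (- 2) / 2)%:E)%E).
  rewrite integral_cst ?measurable_itv//= lebesgue_measure_itv/= lte_fin ltr1n.
  by rewrite -EFinD -EFinM lee_fin; lra.
apply: ge0_le_integral => //; first exact: mf.
move=> t /=; rewrite in_itv/= => /andP[t1 t2]; rewrite lee_fin mulrC.
rewrite ler_pM ?expR_ge0//; last by rewrite ler_expR lerN2.
apply: (@le_trans _ _ (t `^ (- 1))); last by rewrite ler_powR//; lra.
rewrite powRN powRr1; last by lra.
by rewrite lef_pV2 ?posrE//; lra.
Qed.
End Gamma_bounds.


(** * The modified Bessel function and the normalizing constant *)

Section bessel.
Context {R : realType}.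
Variables (nu : R) (nu_gtN1 : -1 < nu).
Implicit Types k l : R.

(** The Bessel series stripped of its factor (k/2)^nu: a power series in k^2, meaningful for every
    real k. *)
Let b k (m : nat) : R := ((k / 2) ^+ 2) ^+ m / (m`!%:R * Gamma (nu + m%:R + 1)).

Let c : R := expR (- 2) / 2.

Let c0 : 0 < c. Proof. by rewrite divr_gt0 ?expR_gt0. Qed.

Let Gamma_c (m : nat) : c <= Gamma (nu + m%:R + 1).
Proof.
by apply: Gamma_lower_bound; rewrite addrAC ltr_wpDr// -ltrBlDr sub0r.
Qed.

Let Gamma_pos (m : nat) : 0 < Gamma (nu + m%:R + 1).
Proof. exact: lt_le_trans (Gamma_c m). Qed.

Let fact_pos (m : nat) : 0 < (m`!%:R : R).
Proof. by rewrite ltr0n fact_gt0. Qed.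

Let b_ge0 k m : 0 <= b k m.
Proof.
apply: divr_ge0; first by rewrite exprn_ge0// sqr_ge0.
by apply: mulr_ge0; apply: ltW; [exact: fact_pos|exact: Gamma_pos].
Qed.

(** The lower bound [c] on [Gamma] dominates the terms by those of c^-1 exp((k/2)^2). *)
Lemma cvg_bessel_series k : cvgn (series (b k)).
Proof.
apply: (@series_le_cvg _ (b k) (fun m => c^-1 * exp_coeff ((k / 2) ^+ 2) m)) => //.
- by move=> m; rewrite mulr_ge0 ?invr_ge0 ?(ltW c0)// exp_coeff_ge0// sqr_ge0.
- move=> m; rewrite /b exp_coeffE invfM mulrCA [leRHS]mulrC -mulrA.
  rewrite [X in _ <= X](_ : _ = (m`!%:R)^-1 * (((k / 2) ^+ 2) ^+ m * c^-1)); last by ring.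
  apply: ler_wpM2l; first by rewrite invr_ge0 ltW.
  apply: ler_wpM2l; first by rewrite exprn_ge0// sqr_ge0.
  by rewrite lef_pV2 ?posrE.
- have -> : (fun m => c^-1 * exp_coeff ((k / 2) ^+ 2) m) = c^-1 *: exp_coeff ((k / 2) ^+ 2).
    by apply/funext.
  by apply: is_cvg_seriesZ; exact: is_cvg_series_exp_coeff.
Qed.

Definition bessel_entire k : R := limn (series (b k)).

(** The left-hand side is the term of index 0, and the others are nonnegative. *)
Lemma bessel_entire_ge k : (Gamma (nu + 1))^-1 <= bessel_entire k.
Proof.
have nd : {homo series (b k) : n m / (n <= m)%N >-> n <= m}.
  by apply/nondecreasing_seqP => m; rewrite /series/= big_nat_recr//= lerDl.
have := nondecreasing_cvgn_le nd (@cvg_bessel_series k) 1.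
by rewrite /series/= big_nat1 /b expr0 mul1r fact0 mul1r addr0.
Qed.

Lemma le_bessel_entire k l : 0 <= k -> k <= l -> bessel_entire k <= bessel_entire l.
Proof.
move=> k0 kl; apply: lim_series_le; [exact: cvg_bessel_series..|] => m.
rewrite /b ler_wpM2r ?invr_ge0 ?mulr_ge0 ?(ltW (Gamma_pos _))//.
have l0 := le_trans k0 kl.
by rewrite !lerXn2r ?nnegrE ?sqr_ge0 ?divr_ge0// ler_wpM2r.
Qed.

Lemma besselIE k : 0 < k -> besselI nu k = (k / 2) `^ nu * bessel_entire k.
Proof.
move=> k0; rewrite /besselI /bessel_entire.
have -> : (fun m : nat => (k / 2) `^ (nu + m.*2%:R) / (m`!%:R * Gamma (nu + m%:R + 1))) =
    (k / 2) `^ nu *: b k.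
  apply/funext => m; rewrite powRD; last by rewrite mulf_neq0 ?implybT ?gt_eqF.
  rewrite powR_mulrn ?divr_ge0 ?(ltW k0)// -mul2n exprM.
  by rewrite -mulrA.
by rewrite lim_seriesZ; last exact: cvg_bessel_series.
Qed.

End bessel.

(** The power k^(p/2 - 1) of the numerator cancels that of the Bessel function, so [h] is a constant
    times [bessel_entire], and [c] is that constant times the term of index 0. *)
Lemma fvml_const_inv (R : realType) (p : nat) : (0 < p)%N ->
  exists h : R -> R, exists2 c : R, 0 < c &
  [/\ forall k, 0 < k -> fvml_const p k = (h k)^-1,
      forall k, c <= h k &
      forall k l, 0 < k -> k <= l -> h k <= h l].
Proof.
move=> p0; set nu : R := p%:R / 2 - 1.
have nu1 : -1 < nu by rewrite /nu ltrBrDr addNr divr_gt0 ?ltr0n.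
pose A : R := (2 * pi) `^ (p%:R / 2) * 2 `^ (- nu).
have A0 : 0 < A by rewrite mulr_gt0 ?powR_gt0 ?mulr_gt0 ?pi_gt0.
exists (fun k => A * bessel_entire nu k); exists (A * (Gamma (nu + 1))^-1).
  rewrite mulr_gt0// invr_gt0.
  apply: lt_le_trans (Gamma_lower_bound _); first by rewrite divr_gt0 ?expR_gt0.
  by rewrite -ltrBlDr sub0r.
split.
- move=> k k0; rewrite /fvml_const -/nu besselIE//.
  have kn0 : k `^ nu != 0 by rewrite gt_eqF// powR_gt0.
  have half : (2^-1 : R) `^ nu = 2 `^ (- nu).
    have t0 : (2 : R) `^ nu != 0 by rewrite gt_eqF// powR_gt0.
    by apply: (mulIf t0); rewrite powRN mulVf// -powRM ?invr_ge0// mulVf// powR1.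
  rewrite [(k / 2) `^ _]powRM ?(ltW k0) ?invr_ge0// half.
  have -> : (2 * pi) `^ (p%:R / 2) * (k `^ nu * 2 `^ (- nu) * bessel_entire nu k) =
      k `^ nu * (A * bessel_entire nu k) by rewrite /A; ring.
  by rewrite invfM mulrA divff// mul1r.
- by move=> k; rewrite ler_wpM2l ?(ltW A0)//; exact: bessel_entire_ge.
- move=> k l k0 kl; rewrite ler_wpM2l ?(ltW A0)//.
  by apply: le_bessel_entire => //; exact: ltW.
Qed.

(** * The Fisher-von Mises-Langevin measures *)

Section fvml_measure.
Context {R : realType} {n : nat}.
Local Notation sigma := (@surface_measure R n).

Lemma surface_measure_fin_num_fun : fin_num_fun sigma.
Proof.
move=> A _; rewrite ge0_fin_numE ?surface_measure_ge0//.
apply: le_lt_trans (@hausdorff_unit_sphere_lty R n); apply: le_hausdorff.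
by move=> _ [x _ <-]; have := set_valP x.
Qed.

HB.instance Definition _ := Measure_isFinite.Build _ (sphere R n) R sigma
  surface_measure_fin_num_fun.

Lemma measurable_sphere_coord (i : 'I_n.+1) :
  measurable_fun [set: sphere R n] (fun x => sphere_val x 0 i).
Proof.
apply: (measurability (@RGenOInfty.G R)); first exact: RGenOInfty.measurableE.
move=> _ [_ [r ->] <-]; rewrite setTI; apply: sub_sigma_algebra.
exists [set x : 'rV[R]_n.+1 | x 0 i \in `]r, +oo[] => //.
have : open ((fun x : 'rV[R]_n.+1 => x 0 i) @^-1` `]r, +oo[%classic).
  apply: open_comp; last exact: interval_open.
  by move=> x _; exact: coord_continuous.
by [].
Qed.

Lemma measurable_dotp_sphere (mu : sphere R n) :
  measurable_fun [set: sphere R n] (fun x => dotp (sphere_val mu) (sphere_val x)).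
Proof.
rewrite /dotp; apply: measurable_sum => i.
by apply: measurable_funM => //; exact: measurable_sphere_coord.
Qed.

Lemma sphere_coord_le1 (x : sphere R n) i : `|sphere_val x 0 i| <= 1.
Proof. by rewrite -(set_valP x : enorm (sphere_val x) = 1) coord_le_enorm. Qed.

Lemma dotp_sphere_le (x y : sphere R n) :
  `|dotp (sphere_val x) (sphere_val y)| <= n.+1%:R.
Proof.
rewrite /dotp -[leRHS]mulr1 -[n.+1 in leRHS]card_ord mulr_natl -sumr_const.
apply: le_trans (ler_norm_sum _ _ _) _; apply: ler_sum => i _.
by rewrite normrM mulr_ile1 ?sphere_coord_le1.
Qed.

(** Passing to the opposite direction is what gives access to negative parameters in the
    exponential. *)
Lemma sphere_opp (x : sphere R n) : exists y : sphere R n, sphere_val y = - sphere_val x.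
Proof.
have xN : - sphere_val x \in @unit_sphere R n.
  rewrite inE /unit_sphere/= /enorm.
  rewrite -(set_valP x : enorm (sphere_val x) = 1).
  by congr Num.sqrt; apply: eq_bigr => i _; rewrite !mxE mulrNN.
by exists (exist (fun y => y \in @unit_sphere R n) _ xN).
Qed.

Lemma measurable_fvml_density (mu : sphere R n) (k : R) :
  measurable_fun [set: sphere R n] (fvml_density mu k).
Proof.
apply: measurable_funM => //; apply: measurableT_comp => //.
by apply: measurable_funM => //; exact: measurable_dotp_sphere.
Qed.

(** The density is bounded, since inner products on the sphere are, and the surface measure is
    finite. *)
Lemma fvml_finite_measure (mu : sphere R n) (k : R) : 0 <= fvml_const n.+1 k ->
  exists P : {finite_measure set (sphere R n) -> \bar R},
    (P : set (sphere R n) -> \bar R) = fvml mu k.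
Proof.
move=> C0; apply: density_finite_measure => [|x|].
- exact: measurable_fvml_density.
- by rewrite mulr_ge0 ?expR_ge0.
apply: (@le_lt_trans _ _ (\int[sigma]_x (fvml_const n.+1 k * expR (`|k| * n.+1%:R))%:E)%E).
  apply: ge0_le_integral => //.
  - by move=> x _; rewrite lee_fin mulr_ge0 ?expR_ge0.
  - by apply/measurable_EFinP; exact: measurable_fvml_density.
  - move=> x _; rewrite lee_fin ler_wpM2l// ler_expR (le_trans (ler_norm _))//.
    by rewrite normrM ler_wpM2l// dotp_sphere_le.
rewrite integral_cst//; apply: lte_mul_pinfty => //.
  by rewrite lee_fin mulr_ge0 ?expR_ge0.
by rewrite -ge0_fin_numE// surface_measure_fin_num_fun.
Qed.

End fvml_measure.

(** * Second differences of exponential integrals *)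

Section second_difference.
Context {R : realType}.

(** Both signs of u follow from 1 + v <= e^v: at v = - u, multiplied by e^u, when u >= 0; at v = u
    otherwise. *)
Lemma expR_sub1_le (u B : R) : `|u| <= B -> (expR u - 1) ^+ 2 <= (u * expR B) ^+ 2.
Proof.
move=> uB; rewrite -[leLHS]real_normK ?num_real// -[leRHS]real_normK ?num_real//.
rewrite lerXn2r ?nnegrE// normrM (ger0_norm (expR_ge0 B)).
have [u0|u0] := leP 0 u.
  have e1 : 1 <= expR u by rewrite -expR0 ler_expR.
  rewrite (ger0_norm u0) in uB *; rewrite ger0_norm ?subr_ge0//.
  apply: (@le_trans _ _ (u * expR u)); last by rewrite ler_wpM2l// ler_expR.
  have := expR_ge1Dx (- u); rewrite expRN => /(ler_wpM2r (expR_ge0 u)).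
  by rewrite mulVf ?gt_eqF ?expR_gt0//; lra.
have e1 : expR u <= 1 by rewrite -expR0 ler_expR ltW.
rewrite ler0_norm ?subr_le0//.
apply: (@le_trans _ _ `|u|); first by rewrite ltr0_norm//; have := expR_ge1Dx u; lra.
by rewrite ler_peMr// -expR0 ler_expR (le_trans _ uB).
Qed.

(* With w = e^u, the left-hand side is (w - 1)^2 (1 + 1/w + 1/w^2). *)
Lemma expR_second_difference (u B : R) : `|u| <= B ->
  `|expR (2 * u) + expR (- (2 * u)) - (expR u + expR (- u))| <=
  expR B ^+ 2 * (1 + expR B + expR B ^+ 2) * u ^+ 2.
Proof.
move=> uB; have w0 := expR_gt0 u.
have vB : expR (- u) <= expR B by rewrite ler_expR (le_trans (ler_norm _))// normrN.
have v0 := expR_gt0 (- u).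
have -> : expR (2 * u) + expR (- (2 * u)) - (expR u + expR (- u)) =
    (expR u - 1) ^+ 2 * (1 + expR (- u) + expR (- u) ^+ 2).
  rewrite mulr_natl mulr2n opprD !expRD expRN; field; exact: lt0r_neq0.
have b0 : 0 <= 1 + expR (- u) + expR (- u) ^+ 2 by have := sqr_ge0 (expR (- u)); lra.
rewrite ger0_norm; last by rewrite mulr_ge0 ?sqr_ge0.
rewrite [leRHS]mulrAC; apply: ler_pM; rewrite ?sqr_ge0//.
- by apply: le_trans (expR_sub1_le uB) _; rewrite exprMn mulrC.
- by rewrite !lerD// lerXn2r ?nnegrE ?(ltW v0) ?expR_ge0.
Qed.

End second_difference.

Section second_difference_integral.
Context d (T : measurableType d) (R : realType).
Variables (mu : {finite_measure set T -> \bar R}) (S f : T -> R) (B : R).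
Hypotheses (mS : measurable_fun [set: T] S) (SB : forall x, `|S x| <= B).
Hypothesis intf : mu.-integrable [set: T] (EFin \o f).

Lemma integrable_mul_expR k :
  mu.-integrable [set: T] (EFin \o (fun x => f x * expR (k * S x))).
Proof.
rewrite (_ : EFin \o _ = (EFin \o f) \* (EFin \o (fun x => expR (k * S x))))%E; last first.
  by apply/funext => x /=; rewrite EFinM.
apply: integrableMl => //.
  by apply: measurableT_comp => //; exact: measurable_funM.
exists (expR (`|k| * B)); split; first by rewrite num_real.
move=> M kM x _ /=; rewrite (le_trans _ (ltW kM))// ger0_norm ?expR_ge0// ler_expR.
by apply: le_trans (ler_norm _) _; rewrite normrM ler_wpM2l.
Qed.

Let J k := \int[mu]_x (f x * expR (k * S x)).

(** This is the quantitative form of the smoothness of F at 0: the pointwise estimate at u = t S(x),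
    of absolute value at most [B] as t <= 1, is integrated against the absolute value of [f]. *)
Lemma Rintegral_second_difference : exists K : R, forall t, 0 < t -> t <= 1 ->
  `|J (2 * t) + J (- (2 * t)) - (J t + J (- t))| <= K * t ^+ 2.
Proof.
pose c := expR B ^+ 2 * (1 + expR B + expR B ^+ 2) * B ^+ 2.
exists (\int[mu]_x (`|f x|) * c) => t t0 t1.
have iJ := integrable_mul_expR.
have iD a b : mu.-integrable [set: T]
    (EFin \o (fun x => f x * expR (a * S x) + f x * expR (b * S x))).
  by have := integrableD measurableT (iJ a) (iJ b).
rewrite /J -!RintegralD// -RintegralB//.
apply: le_trans (le_normr_Rintegral _ _) _ => //.
  by have := integrableB measurableT (iD (2 * t) (- (2 * t))) (iD t (- t)).
have inf : mu.-integrable [set: T] (EFin \o (fun x => `|f x|)).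
  by have := integrable_abse intf.
rewrite -mulrA -RintegralZr//; apply: le_Rintegral => //.
- by have := integrable_abse (integrableB measurableT (iD (2 * t) (- (2 * t))) (iD t (- t))).
- by have := integrableZr measurableT (c * t ^+ 2) inf.
move=> x _; rewrite -!mulrDr -mulrBr normrM ler_wpM2l// !mulNr -(mulrA 2 t).
have tSB : `|t * S x| <= B.
  by rewrite normrM gtr0_norm//; apply: le_trans (SB x); rewrite ler_piMl.
apply: le_trans (expR_second_difference tSB) _; rewrite /c -[leRHS]mulrA.
apply: ler_wpM2l.
  by rewrite mulr_ge0 ?sqr_ge0// addr_ge0 ?sqr_ge0// addr_ge0 ?expR_ge0.
rewrite exprMn mulrC ler_wpM2r ?sqr_ge0// -[leLHS]real_normK ?num_real//.
by rewrite lerXn2r ?nnegrE// (le_trans _ (SB x)).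
Qed.

End second_difference_integral.

Section power_density_integral.
Context d (T : measurableType d) (R : realType).
Local Open Scope ereal_scope.
Variables (P m : {finite_measure set T -> \bar R}) (p : T -> R).
Hypotheses (mp : measurable_fun [set: T] p) (p0 : forall x, (0 <= p x)%R).
Hypothesis PE : forall A, measurable A -> P A = \int[m]_(x in A) (p x)%:E.
Variables (N : nat) (f : N.-tuple T -> R).
Hypothesis mf : measurable_fun [set: N.-tuple T] f.

Let W (x : N.-tuple T) : R := (\prod_(i < N) p (tnth x i))%R.

Let W0 x : (0 <= W x)%R. Proof. by apply: prodr_ge0 => i _. Qed.

Lemma integral_power_density_abs :
  \int[power_measure P N]_x `|(f x)%:E| = \int[power_measure m N]_x `|(f x * W x)%:E|.
Proof.
have [M ME] := power_measure_finite m N.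
rewrite (ge0_integral_power_density mp p0 PE)// -?ME.
- apply: eq_integral => x _; rewrite -!EFinM /= normrM (ger0_norm (W0 x))//.
- by apply: measurableT_comp => //; exact/measurable_EFinP.
Qed.

(** The nonnegative case is applied to the positive and negative parts, which commute with
    multiplication by the weight [W] because [W] is nonnegative. *)
Lemma integral_power_density :
  \int[power_measure P N]_x (f x)%:E = \int[power_measure m N]_x (f x * W x)%:E.
Proof.
have intE (m' : {finite_measure set T -> \bar R}) (g : N.-tuple T -> \bar R) :
    \int[power_measure m' N]_x g x =
    \int[power_measure m' N]_x g^\+ x - \int[power_measure m' N]_x g^\- x.
  by have [Q <-] := power_measure_finite m' N; exact: integralE.
rewrite intE [RHS]intE; have [M ME] := power_measure_finite m N.
have mfE : measurable_fun [set: N.-tuple T] (EFin \o f) by exact/measurable_EFinP.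
rewrite !(ge0_integral_power_density mp p0 PE)// -?ME.
- congr (_ - _); apply: eq_integral => x _.
    rewrite !funeposE -!EFin_max -EFinM; congr (_%:E).
    by rewrite -/(W x) maxr_pMl ?W0// mul0r.
  rewrite !funenegE -!EFinN -!EFin_max -EFinM; congr (_%:E).
  by rewrite -/(W x) maxr_pMl ?W0// mul0r mulNr.
- exact: measurable_funeneg.
- exact: measurable_funepos.
Qed.

End power_density_integral.

(** * Linear growth at 0 against a quadratic second difference *)

Local Open Scope ereal_scope.

Theorem corollary3p2 (R : realType) (n N : nat) (N_ge1 : (1 <= N)%N) :
  ~ exists khat : N.-tuple (sphere R n) -> R,
      measurable_fun [set: N.-tuple (sphere R n)] khat /\
      forall (mu : sphere R n) (kappa : R), (0 < kappa)%R ->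
        \int[power_measure (fvml mu kappa) N]_x `|(khat x)%:E| < +oo /\
        \int[power_measure (fvml mu kappa) N]_x (khat x)%:E = kappa%:E.
Proof.
move=> [khat [mkhat unbiased]].
have [h [c c0 [hE hc hmono]]] := @fvml_const_inv R n.+1 isT.
have h0 k : (0 < h k)%R by exact: lt_le_trans (hc k).
have [sN sNE] := power_measure_finite (@surface_measure R n) N.
pose S (mu : sphere R n) (x : N.-tuple (sphere R n)) : R :=
  (\sum_(i < N) dotp (sphere_val mu) (sphere_val (tnth x i)))%R.
pose B : R := (N%:R * n.+1%:R)%R.
have mS mu : measurable_fun [set: N.-tuple (sphere R n)] (S mu).
  apply: measurable_sum => i.
  apply: (measurableT_comp (measurable_dotp_sphere mu)); exact: measurable_tnth.
have SB mu x : (`|S mu x| <= B)%R.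
  apply: le_trans (ler_norm_sum _ _ _) _.
  rewrite /B -[N in leRHS]card_ord mulr_natl -sumr_const.
  by apply: ler_sum => i _; exact: dotp_sphere_le.
(* [W mu k] is the joint density of the sample with respect to the power [sN] of the surface
   measure. *)
pose W mu k x : R := ((h k)^-1 ^+ N * expR (k * S mu x))%R.
have WE mu k : (0 < k)%R -> forall x,
    (\prod_(i < N) fvml_density mu k (tnth x i))%R = W mu k x.
  move=> k0 x; rewrite /fvml_density big_split/= prodr_const card_ord hE//.
  by rewrite -expR_sum /W /S mulr_sumr.
have intW mu k : (0 < k)%R ->
    \int[sN]_x `|(khat x * W mu k x)%:E| < +oo /\
    \int[sN]_x (khat x * W mu k x)%:E = k%:E.
  move=> k0; have C0 : (0 <= fvml_const n.+1 k)%R by rewrite hE// invr_ge0 ltW.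
  have [P PE] := fvml_finite_measure mu C0.
  have p0 x : (0 <= fvml_density mu k x)%R by rewrite mulr_ge0 ?expR_ge0.
  have PA A : measurable A -> P A = \int[surface_measure]_(x in A) (fvml_density mu k x)%:E.
    by move=> _; rewrite PE.
  have := unbiased mu k k0; rewrite -PE.
  rewrite (integral_power_density_abs (measurable_fvml_density mu k) p0 PA mkhat).
  rewrite (integral_power_density (measurable_fvml_density mu k) p0 PA mkhat) -sNE.
  under eq_integral do rewrite WE//.
  by under [in X in _ /\ X]eq_integral do rewrite WE//.
(* Integrability at the single parameter ([point], 1) suffices: there the joint density is bounded
   below by the positive constant [w]. *)
have intkhat : sN.-integrable [set: N.-tuple (sphere R n)] (EFin \o khat).
  pose w : R := ((h 1)^-1 ^+ N * expR (- B))%R.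
  have w0 : (0 < w)%R by rewrite mulr_gt0 ?expR_gt0 ?exprn_gt0 ?invr_gt0.
  have [Woo _] := intW point 1%R ltr01.
  have mW : measurable_fun [set: N.-tuple (sphere R n)] (fun x => khat x * W point 1 x)%R.
    apply: measurable_funM => //; apply: measurable_funM => //.
    by apply: measurableT_comp => //; exact: measurable_funM.
  have iW : sN.-integrable [set: N.-tuple (sphere R n)]
      (EFin \o (fun x => khat x * W point 1 x)%R).
    by apply/integrableP; split; [exact/measurable_EFinP|exact: Woo].
  have iWw := integrableZr measurableT (w^-1)%R iW.
  apply: le_integrable iWw => //; first exact/measurable_EFinP.
  move=> x _; suff : (`|khat x| <= `|khat x * W point 1 x * w^-1|)%R by [].
  rewrite -mulrA normrM ler_peMr//.
  have Wx0 : (0 < W point 1 x)%R by rewrite mulr_gt0 ?expR_gt0 ?exprn_gt0 ?invr_gt0.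
  have wi0 : (0 < w^-1)%R by rewrite invr_gt0.
  rewrite gtr0_norm; last exact: mulr_gt0.
  rewrite ler_pdivlMr// mul1r /W mul1r ler_wpM2l ?exprn_ge0 ?invr_ge0 ?(ltW (h0 _))//.
  by rewrite ler_expR; have := SB point x; rewrite ler_norml => /andP[].
(* Unbiasedness with the normalizing factor h(k)^(-N) moved to the other side. *)
have IJ mu k : (0 < k)%R ->
    (\int[sN]_x (khat x * expR (k * S mu x)))%R = (k * h k ^+ N)%R.
  move=> k0; have [_ Wk] := intW mu k k0.
  have hN : ((h k)^-1 ^+ N != 0)%R by rewrite expf_neq0// invr_eq0 gt_eqF.
  apply: (mulIf hN); rewrite -RintegralZr//; last first.
    exact: integrable_mul_expR (mS mu) (SB mu) intkhat k.
  rewrite -mulrA -exprMn mulfV ?gt_eqF// expr1n mulr1.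
  apply: EFin_inj; rewrite -Wk /Rintegral.
  rewrite (eq_integral (fun x => (khat x * W mu k x)%:E)) ?Wk// => x _.
  by rewrite /W mulrCA mulrC.
pose mu : sphere R n := point.
have [nu nuE] := sphere_opp mu.
have SN x : S nu x = (- S mu x)%R.
  rewrite /S -sumrN; apply: eq_bigr => i _; rewrite /dotp -sumrN nuE.
  by apply: eq_bigr => j _; rewrite mxE mulNr.
have IJN k : (0 < k)%R ->
    (\int[sN]_x (khat x * expR (- k * S mu x)))%R = (k * h k ^+ N)%R.
  move=> k0; rewrite -(IJ nu k k0); apply: eq_Rintegral => x _.
  by rewrite SN mulrN mulNr.
have [K KP] := Rintegral_second_difference (mS mu) (SB mu) intkhat.
have cN0 : (0 < c ^+ N)%R by rewrite exprn_gt0.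
have den0 : (0 < c ^+ N + `|K|)%R by rewrite ltr_wpDr.
(* Chosen so that 0 < t <= 1 and K t <= c^N, whatever the sign of [K]. *)
pose t : R := (c ^+ N / (c ^+ N + `|K|))%R.
have t0 : (0 < t)%R by rewrite divr_gt0.
have t1 : (t <= 1)%R by rewrite ler_pdivrMr// mul1r lerDl.
have t20 : (0 < 2 * t)%R by rewrite mulr_gt0.
have := KP t t0 t1; rewrite (IJN _ t20) (IJ mu _ t20) (IJN _ t0) (IJ mu _ t0).
have H1 : (c ^+ N <= h t ^+ N)%R by rewrite lerXn2r ?nnegrE ?(ltW c0) ?(ltW (h0 _)).
have H2 : (h t ^+ N <= h (2 * t) ^+ N)%R.
  rewrite lerXn2r ?nnegrE ?(ltW (h0 _))// hmono//.
  by rewrite ler_peMl ?(ltW t0)// ler1n.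
have Kt : (K * t <= c ^+ N)%R.
  apply: (@le_trans _ _ (`|K| * t)%R); first by rewrite ler_wpM2r ?(ltW t0)// ler_norm.
  by rewrite /t mulrCA ler_piMr ?(ltW cN0)// ler_pdivrMr// mul1r lerDr ltW.
(* With H1 = h(t)^N and H2 = h(2t)^N, the second difference is 4 t H2 - 2 t H1 >= 2 t c^N, whereas K
   t^2 <= t c^N. *)
move: (h t ^+ N)%R (h (2 * t) ^+ N)%R H1 H2 => H1 H2 cH1 H12.
move=> /(le_trans (ler_norm _)); apply/negP; rewrite -ltNge.
have -> : (K * t ^+ 2 = K * t * t)%R by rewrite expr2 mulrA.
nra.
Qed.
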